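(* Let $\beta\in[0,1/2)$. Then $$\lim_{N\to\infty\vert \beta}\frac{\overline{T}(N,p)}{N p |\log p|}=\frac{1}{(\log 2)^2}.$$
   Context: Probabilistic group testing with two-stage algorithms. Let $N\ge 1$ be an integer and $p\in(0,1)$. A configuration $X=(x_1,\dots,x_N)\in\{0,1\}^N$ is drawn from the Bernoulli product measure $\mu_p(X)=\prod_{i=1}^N p^{x_i}(1-p)^{1-x_i}$; variable $i$ is defective iff $x_i=1$. A first stage with $M\ge1$ tests is given by an $N\times M$ binary connectivity matrix $C_{N,M}=(c_{i,a})$; variable $i$ belongs to pool (test) $a$ iff $c_{i,a}=1$. The outcome of test $a$ is $T_a=0$ if $c_{i,a}x_i=0$ for all $i$, and $T_a=1$ otherwise. Variable $i$ is a sure zero if there is a test $a$ with $c_{i,a}=1$ and $T_a=0$. Variable $i$ is a sure one if $x_i=1$ and there is a test $a$ with $c_{i,a}=1$ such that every $j\neq i$ with $c_{j,a}=1$ is a sure zero. Let $\mathcal U_0$ be the set of $i$ with $x_i=0$ that are not sure zeros and $\mathcal U_1$ the set of $i$ with $x_i=1$ that are not sure ones (these are tested individually in the second stage). Set $T(X,M,C_{N,M}):=M+|\mathcal U_0|+|\mathcal U_1|$, $T_{M,C_{N,M},p}:=\sum_{X\in\{0,1\}^N}\mu_p(X)\,T(X,M,C_{N,M})$, and $\overline T(N,p):=\min_{M\in\{1,\dots,N\}}\min_{C_{N,M}\in\{0,1\}^{N\times M}}T_{M,C_{N,M},p}$. Here $\log$ is the natural logarithm. Limit notation: for $\beta>0$,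 $\lim_{N\to\infty\vert\beta}f(N,p):=\lim_{N\to\infty}f(N,N^{-\beta})$; for $\beta=0$, $\lim_{N\to\infty\vert 0}f(N,p):=\lim_{p\to0}\lim_{N\to\infty}f(N,p)$. *)

(* Defs.v *)
From HB Require Import structures.
From mathcomp Require Import all_boot all_order all_algebra.
From mathcomp Require Import all_classical all_reals all_analysis.
Set Implicit Arguments. Unset Strict Implicit. Unset Printing Implicit Defensive.
Import Order.TTheory GRing.Theory Num.Theory.
Import numFieldNormedType.Exports.
Local Open Scope classical_set_scope.
Local Open Scope ring_scope.

Section GroupTesting.
Variables (N M : nat).
(* configuration X : x_i = X i ; connectivity matrix C : c_{i,a} = C i a *)
Implicit Types (X : {ffun 'I_N -> bool}) (C : 'M[bool]_(N, M)).

Definition test_outcome X C (a : 'I_M) : bool := [exists j, C j a && X j].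

Definition sure_zero X C (i : 'I_N) : bool :=
  [exists a, C i a && ~~ test_outcome X C a].

Definition sure_one X C (i : 'I_N) : bool :=
  X i && [exists a, C i a &&
     [forall j, ((j != i) && C j a) ==> sure_zero X C j]].

Definition U0 X C : {set 'I_N} := [set i | ~~ X i && ~~ sure_zero X C i].
Definition U1 X C : {set 'I_N} := [set i | X i && ~~ sure_one X C i].

Definition Tcost X C : nat := (M + #|U0 X C| + #|U1 X C|)%N.

Variable R : realType.

Definition mu (p : R) X : R := \prod_(i < N) (if X i then p else 1 - p).

Definition Tavg (p : R) C : R := \sum_(X : {ffun 'I_N -> bool}) mu p X * (Tcost X C)%:R.

(* minimum over all connectivity matrices with M columns (the seed
   Tavg p (const_mx false) is itself one of the minimized values) *)
Definition Tmin_M (p : R) : R :=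
  \big[Order.min/Tavg p (const_mx false)]_(C : 'M[bool]_(N, M)) Tavg p C.
End GroupTesting.

(* overline T(N, p) = min over M in {1,...,N} and C of T_{M,C,p}
   (seed = value for M = 1, itself one of the minimized values) *)
Definition Tbar (R : realType) (N : nat) (p : R) : R :=
  \big[Order.min/Tmin_M N 1 p]_(k < N) Tmin_M N k.+1 p.

Definition lim_beta (R : realType) (beta : R) (f : nat -> R -> R) (c : R) : Prop :=
  if (0 < beta) then
    (fun N : nat => f N (N%:R `^ (- beta))) @ \oo --> c
  else
    exists delta : R, 0 < delta /\
    exists g : R -> R,
      (forall p, 0 < p < delta -> (fun N : nat => f N p) @ \oo --> g p) /\
      g @ at_right 0 --> c.

(* Main.v *)
Require Import Defs.
From HB Require Import structures.
From mathcomp Require Import all_boot all_order all_algebra.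
From mathcomp Require Import all_classical all_reals all_analysis.
From mathcomp Require Import ring lra zify.
Set Implicit Arguments. Unset Strict Implicit. Unset Printing Implicit Defensive.
Import Order.TTheory GRing.Theory Num.Theory.
Import numFieldNormedType.Exports.
Local Open Scope ring_scope.

(**
  Lower bound. An item i is an undetected zero iff x_i = 0 and each of its pools
  contains another defective item. These are increasing events, so Harris'
  inequality bounds the probability below by q prod_a (1 - q^(n_a - 1)), where
  q = 1 - p and n_a is the size of pool a. Since ln u ln (1 - u) <= (ln 2)^2,
  each pool contributes at most Phi = |ln p| + (ln 2)^2 / p to the sum over
  items of the logarithms, and linearising the exponential at the optimal point
  gives T >= N (1 + ln (q Phi)) / Phi for every design.

  Upper bound. Let the items be grid points (x, y) with 0 <= x < m and let the
  pools be the lines y + a x = b with 0 <= a < L. Two points lie on at most one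
  common line, so the pools of an item are independent, and an undetected zero
  has probability at most (1 - q^(m - 1))^L. With m ~ ln 2 / p and
  L ~ |ln p| / ln 2 this is at most p, and there are about L N / m + L^2 m
  pools; the boundary term L^2 m is negligible exactly because N p^2 dominates
  |ln p|, i.e. beta < 1/2. The undetected ones cost at most N p = o(N p |ln p|).

  For beta = 0 the limit in N exists because block designs make the optimal
  cost subadditive in N.
*)

(** * Product Bernoulli measure *)

Section Expectation.
Variables (R : realType) (N : nat) (p : R).
Local Notation config := {ffun 'I_N -> bool}.
Implicit Types (X Y : config) (f g : config -> R) (i j : 'I_N) (s : seq 'I_N).

Definition expect f : R := \sum_X mu p X * f X.

Definition upd X i b : config := [ffun j => if j == i then b else X j].

(** Conditional expectation of [f] given all coordinates but [i]. Composing it over every coordinate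
    turns statements about expectations into one-coordinate inductions. *)
Definition resample i f X : R := p * f (upd X i true) + (1 - p) * f (upd X i false).

(** Plain non-dependence on one coordinate. Two functions are probabilistically independent as soon
    as, at each coordinate, one of them has this property. *)
Definition indep i f := forall X b, f (upd X i b) = f X.

Definition isotone f := forall X Y, (forall j, X j ==> Y j) -> f X <= f Y.

Lemma updE X i b j : upd X i b j = if j == i then b else X j.
Proof. by rewrite ffunE. Qed.

Lemma upd_id X i : upd X i (X i) = X.
Proof. by apply/ffunP => j; rewrite updE; case: eqP => [->|]. Qed.

Lemma upd_upd X i b c : upd (upd X i b) i c = upd X i c.
Proof. by apply/ffunP => j; rewrite !updE; case: eqP. Qed.

Lemma updC X i j b c : i != j -> upd (upd X i b) j c = upd (upd X j c) i b.
Proof.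
move=> ij; apply/ffunP => k; rewrite !updE.
by case: (eqVneq k j) => // ->; rewrite eq_sym (negPf ij).
Qed.

Lemma eq_expect f g : f =1 g -> expect f = expect g.
Proof. by move=> fg; apply: eq_bigr => X _; rewrite fg. Qed.

Lemma mu_sum : \sum_(X : config) mu p X = 1.
Proof.
rewrite -(bigA_distr_bigA (fun (i : 'I_N) (b : bool) => if b then p else 1 - p)).
by rewrite big1 // => i _; rewrite big_bool /=; ring.
Qed.

Lemma expect_cst c : expect (fun=> c) = c.
Proof. by rewrite /expect -mulr_suml mu_sum mul1r. Qed.

Lemma expectD f g : expect (fun X => f X + g X) = expect f + expect g.
Proof. by rewrite /expect -big_split; apply: eq_bigr => X _; rewrite mulrDr. Qed.

Lemma expectB f g : expect (fun X => f X - g X) = expect f - expect g.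
Proof. by rewrite /expect -sumrB; apply: eq_bigr => X _; rewrite mulrBr. Qed.

Lemma expect_sum (I : Type) (r : seq I) (F : I -> config -> R) :
  expect (fun X => \sum_(k <- r) F k X) = \sum_(k <- r) expect (F k).
Proof. by rewrite /expect exchange_big; apply: eq_bigr => X _; rewrite mulr_sumr. Qed.

(** Configurations that differ only at [i] are paired; the member with [X i] true stands for the
    pair. *)
Lemma sum_config i (G : config -> R) :
  \sum_X G X = \sum_(X : config | X i) (G X + G (upd X i false)).
Proof.
rewrite (bigID (fun X : config => X i)) /= big_split /=; congr (_ + _).
rewrite (reindex_onto (fun X => upd X i false) (fun X => upd X i true)) /=; last first.
  by move=> X /negPf Xi; rewrite upd_upd -{2}(upd_id X i) Xi.
apply: eq_bigl => X; rewrite updE eqxx /= upd_upd.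
by apply/eqP/idP => [<-|Xi]; rewrite ?updE ?eqxx // -{2}(upd_id X i) Xi.
Qed.

Lemma mu_upd X i b :
  mu p (upd X i b) = (if b then p else 1 - p) *
    \prod_(j < N | j != i) (if X j then p else 1 - p).
Proof.
rewrite /mu (bigD1 i) //= updE eqxx; congr (_ * _).
by apply: eq_bigr => j /negPf ji; rewrite updE ji.
Qed.

(** In each such pair the weights are [p] and [1 - p] times a common factor, so replacing both
    values by their weighted mean leaves the sum unchanged. *)
Lemma expect_resample i f : expect (resample i f) = expect f.
Proof.
rewrite /expect !(sum_config i); apply: eq_bigr => X Xi.
have XE : X = upd X i true by rewrite -{1}(upd_id X i) Xi.
rewrite [mu p X](congr1 (mu p) XE) [f X](congr1 f XE).
rewrite /resample !mu_upd !upd_upd; ring.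
Qed.

Lemma indep_resample i f : indep i (resample i f).
Proof. by move=> X b; rewrite /resample !upd_upd. Qed.

Lemma resample_indep i f X : indep i f -> resample i f X = f X.
Proof. by move=> fi; rewrite /resample !fi; ring. Qed.

Lemma resample_indep_preserved i j f : indep j f -> indep j (resample i f).
Proof.
move=> fj; have [<-|ij] := eqVneq i j; first exact: indep_resample.
by move=> X b; rewrite /resample !(updC _ _ _ (negbT (etrans (eq_sym j i) (negPf ij)))) !fj.
Qed.

Lemma indep_foldr s j f : (j \in s) || `[< indep j f >] ->
  indep j (foldr resample f s).
Proof.
elim: s => [|i s IH] /=; first by move/asboolP.
rewrite in_cons -orbA => /orP[/eqP ->|js]; first exact: indep_resample.
exact/resample_indep_preserved/IH.
Qed.

(** [X] is turned into [Y] one coordinate at a time without changing the value of [f]. *)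
Lemma indep_all_cst f X Y : (forall i, indep i f) -> f X = f Y.
Proof.
move=> fi; pose mix s := foldr (fun i Z => upd Z i (Y i)) X s.
have fmix s : f (mix s) = f X by elim: s => //= i s IH; rewrite fi.
rewrite -(fmix (enum 'I_N)); congr f; apply/ffunP => j.
have : j \in enum 'I_N by rewrite mem_enum.
elim: (enum _) => //= i s IH; rewrite in_cons updE.
by case: eqP => [->|] //= _ /IH.
Qed.

Lemma expect_foldr s f : expect (foldr resample f s) = expect f.
Proof. by elim: s => //= i s IH; rewrite expect_resample. Qed.

(** Once every coordinate has been resampled the function is constant, and resampling preserves the
    expectation. *)
Lemma expect_foldr_enum f X : foldr resample f (enum 'I_N) X = expect f.
Proof.
rewrite -(expect_foldr (enum 'I_N)) -[LHS]expect_cst; apply: eq_expect => Y.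
by apply: indep_all_cst => i; apply: indep_foldr; rewrite mem_enum.
Qed.

(** At each coordinate one factor is unaffected by resampling, so resampling the product is the
    product of the resampled factors. *)
Lemma expect_mul_indep f g : (forall i, indep i f \/ indep i g) ->
  expect (fun X => f X * g X) = expect f * expect g.
Proof.
move=> fg; pose X0 : config := [ffun=> false].
rewrite -!(expect_foldr_enum _ X0).
elim: (enum _) X0 => //= i s IH X.
rewrite {1}/resample !IH.
have [fi|gi] := fg i.
  have {}fi : indep i (foldr resample f s).
    by apply: indep_foldr; rewrite (asboolT fi) orbT.
  by rewrite (resample_indep X fi) /resample !fi; ring.
have {}gi : indep i (foldr resample g s).
  by apply: indep_foldr; rewrite (asboolT gi) orbT.
by rewrite (resample_indep X gi) /resample !gi; ring.
Qed.

Lemma expect_prod_indep (I : eqType) (r : seq I) (F : I -> config -> R) :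
  uniq r ->
  (forall a b, a \in r -> b \in r -> a != b -> forall i, indep i (F a) \/ indep i (F b)) ->
  expect (fun X => \prod_(a <- r) F a X) = \prod_(a <- r) expect (F a).
Proof.
elim: r => [|a r IH] /=.
  by rewrite big_nil -[RHS]expect_cst => *; apply: eq_expect => X; rewrite big_nil.
move=> /andP[ar ur] H; rewrite big_cons -IH //; last first.
  by move=> b c br cr; apply: H; rewrite in_cons ?br ?cr orbT.
rewrite -expect_mul_indep; first by apply: eq_expect => X; rewrite big_cons.
(* If the head factor depends on [i], the pairwise hypothesis rules out such a dependence for every
   other factor, hence for their product. *)
move=> i; have [fi|nfi] := pselect (indep i (F a)); [by left|right => X c].
rewrite !big_seq; apply: eq_bigr => b br.
have ab : a != b by apply: contraNneq ar => ->.
have br' : b \in a :: r by rewrite in_cons br orbT.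
by case: (H a b (mem_head _ _) br' ab i) => // ->.
Qed.

(** * Monotonicity and positive correlation *)

Hypothesis p01 : 0 <= p <= 1.

Let p_ge0 : 0 <= p. Proof. by case/andP: p01. Qed.
Let q_ge0 : 0 <= 1 - p. Proof. by case/andP: p01 => _; rewrite subr_ge0. Qed.

Lemma mu_ge0 X : 0 <= mu p X.
Proof. by apply: prodr_ge0 => i _; case: ifP. Qed.

Lemma le_expect f g : (forall X, f X <= g X) -> expect f <= expect g.
Proof. by move=> fg; apply: ler_sum => X _; rewrite ler_wpM2l ?mu_ge0. Qed.

Lemma upd_le X Y i b c : b ==> c -> (forall j, X j ==> Y j) ->
  forall j, upd X i b j ==> upd Y i c j.
Proof. by move=> bc XY j; rewrite !updE; case: eqP. Qed.

Lemma resample_isotone i f : isotone f -> isotone (resample i f).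
Proof.
move=> fm X Y XY.
by apply: lerD; apply: ler_wpM2l => //; apply: fm; apply: upd_le.
Qed.

Lemma resample_mul_ge i f g X : isotone f -> isotone g ->
  resample i f X * resample i g X <= resample i (fun Y => f Y * g Y) X.
Proof.
move=> fm gm; rewrite /resample.
have le h : isotone h -> 0 <= h (upd X i true) - h (upd X i false).
  by move=> hm; rewrite subr_ge0; apply: hm; apply: upd_le => // j; apply/implyP.
have := mulr_ge0 (mulr_ge0 p_ge0 q_ge0) (mulr_ge0 (le _ fm) (le _ gm)).
set f1 := f _; set f0 := f _; set g1 := g _; set g0 := g _ => h.
by rewrite -subr_ge0; apply: le_trans h _; rewrite le_eqVlt; apply/orP; left; apply/eqP; ring.
Qed.

Lemma foldr_resample_isotone s f : isotone f -> isotone (foldr resample f s).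
Proof. by move=> fm; elim: s => //= i s IH; apply: resample_isotone. Qed.

(* Harris' inequality: when one coordinate is resampled, the covariance is
   pq (f1 - f0) (g1 - g0) >= 0. *)
Lemma expect_mul_isotone f g : isotone f -> isotone g ->
  expect f * expect g <= expect (fun X => f X * g X).
Proof.
move=> fm gm; pose X0 : config := [ffun=> false].
rewrite -!(expect_foldr_enum _ X0).
elim: (enum _) X0 => //= i s IH X.
apply: le_trans (resample_mul_ge _ _ (foldr_resample_isotone s fm) (foldr_resample_isotone s gm)) _.
by apply: lerD; apply: ler_wpM2l.
Qed.

Lemma isotone_prod (I : Type) (r : seq I) (F : I -> config -> R) :
  (forall a, isotone (F a)) -> (forall a X, 0 <= F a X) ->
  isotone (fun X => \prod_(a <- r) F a X).
Proof.
move=> Fm F0 X Y XY.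
by apply: ler_prod => a _; rewrite F0 Fm.
Qed.

(** Harris' inequality iterated; nonnegativity keeps the partial products isotone. *)
Lemma expect_prod_isotone (I : Type) (r : seq I) (F : I -> config -> R) :
  (forall a, isotone (F a)) -> (forall a X, 0 <= F a X) ->
  \prod_(a <- r) expect (F a) <= expect (fun X => \prod_(a <- r) F a X).
Proof.
move=> Fm F0; elim: r => [|a r IH].
  by rewrite big_nil -[leLHS]expect_cst le_expect // => X; rewrite big_nil.
rewrite big_cons; under [X in _ <= X]eq_expect do rewrite big_cons.
apply: le_trans (expect_mul_isotone (Fm a) (isotone_prod _ Fm F0)).
apply: ler_wpM2l IH.
by rewrite -[leLHS](expect_cst 0) le_expect.
Qed.

End Expectation.

(** * Pools *)

Section Pools.
Variables (R : realType) (N : nat) (p : R).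
Local Notation config := {ffun 'I_N -> bool}.
Implicit Types (X : config) (D : {set 'I_N}) (i j : 'I_N).

(** A real-valued indicator, so that a conjunction of positive tests becomes a product. *)
Definition hit D X : R := [exists j, (j \in D) && X j]%:R.

Lemma hit_indep D i : i \notin D -> indep i (hit D).
Proof.
move=> iD X b; rewrite /hit; congr (nat_of_bool _)%:R; apply: eq_existsb => j.
by rewrite updE; case: eqP => // ->; rewrite (negPf iD).
Qed.

Lemma hit_isotone D : isotone (hit D).
Proof.
move=> X Y XY; rewrite /hit ler_nat; case: existsP => [[j /andP[jD Xj]]|//].
by rewrite lt0b; apply/existsP; exists j; rewrite jD; apply: implyP (XY j) Xj.
Qed.

Lemma hit_ge0 D X : 0 <= hit D X.
Proof. exact: ler0n. Qed.

Lemma expect_hit D : expect p (hit D) = 1 - (1 - p) ^+ #|D|.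
Proof.
have -> : hit D = fun X => 1 - \prod_i (~~ ((i \in D) && X i))%:R.
  apply/funext => X; rewrite /hit; case: existsP => [[j jX]|nX].
    by rewrite (bigD1 j) //= jX mul0r subr0.
  by rewrite big1 ?subrr // => i _; case: andP => // iX; case: nX; exists i; apply/andP.
rewrite expectB expect_cst; congr (_ - _).
(* Weight and indicator are both products over coordinates, so the sum over configurations factors
   into sums over a single bit. *)
rewrite /expect; under eq_bigr do rewrite -big_split /=.
rewrite -(bigA_distr_bigA (fun (i : 'I_N) (b : bool) =>
  (if b then p else 1 - p) * (~~ ((i \in D) && b))%:R)) /=.
rewrite (bigID (mem D)) /= [X in _ * X]big1 ?mulr1 => [|i /negPf iD]; last first.
  by rewrite big_bool iD /=; ring.
rewrite (eq_bigr (fun=> 1 - p)) ?prodr_const // => i iD.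
by rewrite big_bool iD /=; ring.
Qed.

Variables (M : nat) (C : 'M[bool]_(N, M)).

Definition pool (a : 'I_M) : {set 'I_N} := [set j | C j a]%SET.

Lemma mem_pool a i : (i \in pool a) = C i a.
Proof. by rewrite inE. Qed.

(** When [X i] is false, removing [i] from its pools does not affect their outcomes. It makes the
    product free of coordinate [i], hence independent of the first factor. *)
Lemma U0_indicator X i : (i \in U0 X C)%:R =
  (1 - hit [set i]%SET X) * \prod_(a | C i a) hit (pool a :\ i)%SET X :> R.
Proof.
have -> : hit [set i]%SET X = (X i)%:R.
  rewrite /hit; congr (nat_of_bool _)%:R; apply/existsP/idP => [[j]|Xi].
    by rewrite inE => /andP[/eqP->].
  by exists i; rewrite inE eqxx.
rewrite inE; have [Xi|nXi] /= := boolP (X i); first by rewrite subrr mul0r.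
have outE a : test_outcome X C a = [exists j, (j \in (pool a :\ i)%SET) && X j].
  apply/existsP/existsP => -[j /andP[jC Xj]]; exists j; rewrite Xj andbT.
    by rewrite !inE jC andbT; apply: contraNneq nXi => <-.
  by move: jC; rewrite !inE => /andP[].
rewrite subr0 mul1r.
have [/existsP[a /andP[Cia /negPf na]]|] := boolP (sure_zero X C i).
  by rewrite (bigD1 a) //= /hit -outE na mul0r.
rewrite negb_exists => /forallP H.
rewrite big1 // => a Cia; rewrite /hit -outE.
by move: (H a); rewrite Cia /= negbK => ->.
Qed.

Lemma expect_U0 i : expect p (fun X => (i \in U0 X C)%:R) =
  (1 - p) * expect p (fun X => \prod_(a | C i a) hit (pool a :\ i)%SET X).
Proof.
under eq_expect do rewrite U0_indicator.
rewrite expect_mul_indep.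
  by rewrite expectB expect_cst expect_hit cards1 expr1; congr (_ * _); ring.
move=> j; have [->|ji] := eqVneq j i.
  right => X b; apply: eq_bigr => a _; rewrite hit_indep //.
  by rewrite !inE eqxx.
by left => X b; rewrite hit_indep // inE.
Qed.

Lemma TavgE : Tavg p C = M%:R +
  \sum_i expect p (fun X => (i \in U0 X C)%:R) +
  expect p (fun X => #|U1 X C|%:R).
Proof.
rewrite -[M%:R](expect_cst N p) -expect_sum -!expectD.
apply: eq_bigr => X _; congr (_ * _).
rewrite /Tcost !natrD; congr (_ + _ + _).
by rewrite -sum1_card natr_sum big_mkcond; apply: eq_bigr => i _; case: ifP.
Qed.

Hypothesis p01 : 0 <= p <= 1.

Lemma expect_U0_ge i : (1 - p) * \prod_(a | C i a) (1 - (1 - p) ^+ #|pool a|.-1)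
  <= expect p (fun X => (i \in U0 X C)%:R).
Proof.
case/andP: (p01) => p0 p1; rewrite expect_U0 ler_wpM2l ?subr_ge0 //.
have -> : \prod_(a | C i a) (1 - (1 - p) ^+ #|pool a|.-1) =
   \prod_(a <- [seq a <- index_enum 'I_M | C i a]) expect p (hit (pool a :\ i)%SET).
  rewrite big_filter; apply: eq_bigr => a Cia; rewrite expect_hit; congr (1 - _ ^+ _).
  by rewrite (cardsD1 i (pool a)) mem_pool Cia.
under [leRHS]eq_expect do rewrite -big_filter.
by apply: expect_prod_isotone => // a; apply: hit_isotone.
Qed.

Lemma expect_U1_ge0 : 0 <= expect p (fun X => #|U1 X C|%:R).
Proof. by rewrite -[leLHS](expect_cst N p) le_expect // => X; rewrite ler0n. Qed.

(** Undetected ones are at most all the defectives, whose mean number [N p] is of lower order than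
    [N p |ln p|] as [p] tends to 0. *)
Lemma expect_U1_le : expect p (fun X => #|U1 X C|%:R) <= N%:R * p.
Proof.
apply: (@le_trans _ _ (expect p (fun X => \sum_i hit [set i]%SET X))).
  apply: le_expect => // X; rewrite -sum1_card natr_sum [leLHS]big_mkcond ler_sum //= => i _.
  case: ifP; rewrite ?hit_ge0 // inE => /andP[Xi _]; rewrite /hit ler1n lt0b.
  by apply/existsP; exists i; rewrite inE eqxx.
rewrite expect_sum (eq_bigr (fun=> p)) => [|i _].
  by rewrite sumr_const card_ord mulr_natl.
by rewrite expect_hit cards1 expr1; ring.
Qed.

(** Two pools of [i] meet only in [i], so after its removal they are disjoint and their hits are
    independent. Here [n] bounds the number of other items in a pool. *)
Lemma expect_U0_le i (n L : nat) :
  (L <= #|[pred a | C i a]|)%N ->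
  (forall a, C i a -> (#|pool a| <= n.+1)%N) ->
  (forall a b j, C i a -> C i b -> C j a -> C j b -> a != b -> j = i) ->
  expect p (fun X => (i \in U0 X C)%:R) <= (1 - (1 - p) ^+ n) ^+ L.
Proof.
move=> Ld size_le meet; case/andP: (p01) => p0 p1.
have q0 : 0 <= 1 - p by rewrite subr_ge0.
have q1 : 1 - p <= 1 by rewrite gerBl.
rewrite expect_U0; under eq_expect do rewrite -big_filter.
rewrite expect_prod_indep ?filter_uniq ?index_enum_uniq //; last first.
  move=> a b; rewrite !mem_filter => /andP[Cia _] /andP[Cib _] ab j.
  have [ja|] := boolP (j \in (pool a :\ i)%SET); last by left; apply: hit_indep.
  right; apply: hit_indep; move: ja; rewrite !inE => /andP[ji Cja].
  by rewrite ji /=; apply: contra ji => Cjb; apply/eqP; apply: (meet a b).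
apply: (@le_trans _ _ (\prod_(a <- [seq a <- index_enum 'I_M | C i a]) (1 - (1 - p) ^+ n))).
  rewrite -[leRHS]mul1r ler_pM //.
    by apply: prodr_ge0 => a _; rewrite -[leLHS](expect_cst N p) le_expect // => X; apply: hit_ge0.
  rewrite !big_filter; apply: ler_prod => a Cia.
  rewrite expect_hit subr_ge0 exprn_ile1 //= lerD2l lerN2.
  apply: ler_wiXn2l => //.
  by have := size_le a Cia; rewrite (cardsD1 i (pool a)) mem_pool Cia.
rewrite big_filter prodr_const.
apply: ler_wiXn2l => //; first by rewrite subr_ge0 exprn_ile1.
by rewrite gerBl exprn_ge0.
Qed.

End Pools.

(** * Contribution of one pool *)

Section Analytic.
Variable R : realType.
Implicit Types (p u x : R).

(* This compares the slopes of the chords of ln over [x, 1] and over [1 - x, 1]. *)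
Lemma ln_chord x : 0 < x -> x <= 2^-1 -> x * ln x <= (1 - x) * ln (1 - x).
Proof.
move=> x0 x2.
have x1 : 0 < 1 - x by lra.
have t0 : 0 <= x / (1 - x) by rewrite divr_ge0 // ltW.
have t1 : x / (1 - x) <= 1 by rewrite ler_pdivrMr //; lra.
have := @concave_ln R (Itv01 t0 t1) x 1 x0 ltr01.
rewrite !convRE /= ln1 mulr0 addr0.
have -> : x / (1 - x) * x + unstable.onem (x / (1 - x)) * 1 = 1 - x.
  by rewrite /unstable.onem; field; rewrite gt_eqF.
by rewrite mulrAC ler_pdivrMr // => /le_trans; apply; rewrite mulrC.
Qed.

(** By the symmetry between [u] and [1 - u] one may take [u <= 1/2]; up to [1/2] the derivative is
    nonnegative by [ln_chord], so the maximum is at [1/2]. *)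
Lemma ln_mul_ln_le u : 0 < u < 1 -> ln u * ln (1 - u) <= ln 2 ^+ 2.
Proof.
wlog u2 : u / u <= 2^-1 => [H|] /andP[u0 u1].
  have [h|h] := leP u 2^-1; first by apply: H => //; apply/andP.
  have := H (1 - u); rewrite subKr mulrC; apply; [lra|apply/andP; split; lra].
pose f : R -> R := (@ln R) * (@ln R \o (fun x => 1 - x)).
have df x : 0 < x < 1 ->
    is_derive x 1 f (ln x * (- (1 - x)^-1) + ln (1 - x) * x^-1).
  move=> /andP[x0 x1].
  have d1 := is_derive1_ln x0.
  have x10 : 0 < 1 - x by lra.
  have d2 := is_derive1_ln x10.
  have d3 : is_derive x 1 (fun x : R => 1 - x) (-1).
    have := @is_deriveB R R R (cst 1) id x 1 0 1 _ _.
    by rewrite sub0r; apply.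
  have d4 : is_derive x 1 (@ln R \o (fun x => 1 - x)) (- (1 - x)^-1).
    have := @is_derive1_comp R (@ln R) (fun x => 1 - x) x _ _ d2 d3.
    by rewrite mulrN1.
  exact: (is_deriveM d1 d4).
have dfd x : 0 < x < 1 -> derivable f x 1 by move=> /df[].
have -> : ln 2 ^+ 2 = f 2^-1.
  rewrite /f /GRing.mul /= (_ : 1 - 2^-1 = 2^-1); last by field.
  by rewrite lnV ?posrE // mulrNN expr2.
change (f u <= f 2^-1).
apply: (@ger0_derive1_ndecr R f u 2^-1) => //.
- move=> x; rewrite in_itv /= => /andP[ux x2].
  by apply: dfd; apply/andP; split; lra.
- move=> x; rewrite in_itv /= => /andP[ux x2].
  have x0 : 0 < x by lra.
  have x10 : 0 < 1 - x by lra.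
  rewrite derive1E (@derive_val _ _ _ _ _ _ _ (df x _)); last by apply/andP; split; lra.
  have -> : ln x * (- (1 - x)^-1) + ln (1 - x) * x^-1 =
     ((1 - x) * ln (1 - x) - x * ln x) / (x * (1 - x)).
    by field; rewrite !gt_eqF.
  by rewrite divr_ge0 ?mulr_ge0 ?(ltW x0) ?(ltW x10) // subr_ge0 ln_chord //; lra.
- apply: derivable_within_continuous => x; rewrite in_itv /= => /andP[ux x2].
  by apply: dfd; apply/andP; split; lra.
Qed.

Definition Phi p : R := - ln p + ln 2 ^+ 2 / p.

Lemma Phi_gt0 p : 0 < p < 1 -> 0 < Phi p.
Proof.
move=> /andP[p0 p1]; rewrite /Phi addr_gt0 //; first by rewrite oppr_gt0 ln_lt0 // p0.
by rewrite divr_gt0 // exprn_gt0 // ln_gt0 // ltr1n.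
Qed.

Lemma ln1B_le p : p < 1 -> ln (1 - p) <= - p.
Proof. by move=> p1; apply: le_ln1Dx; rewrite ltrN2. Qed.

(** Let [u = (1 - p) ^+ k]. One of the [k + 1] members costs at most [- ln p] because [1 - u >= p];
    the other [k] cost at most [ln u * ln (1 - u) / p] because [k p <= - ln u]. These are the two
    terms of [Phi p]. *)
Lemma pool_cost p k : 0 < p < 1 -> (0 < k)%N ->
  k.+1%:R * (- ln (1 - (1 - p) ^+ k)) <= Phi p.
Proof.
move=> /andP[p0 p1] k0.
have q0 : 0 < 1 - p by lra.
have q1 : 1 - p < 1 by lra.
set u := _ ^+ k.
have u0 : 0 < u by rewrite exprn_gt0.
have uq : u <= 1 - p by rewrite -[leRHS]expr1; apply: ler_wiXn2l => //; exact: ltW.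
have pu : p <= 1 - u by lra.
have lu : - ln (1 - u) <= - ln p by rewrite lerN2 ler_ln ?posrE //; lra.
have lu0 : 0 <= - ln (1 - u) by rewrite oppr_ge0 ln_le0 //; lra.
have kp : k%:R * p <= - ln u.
  rewrite lnXn // -[ln _ *+ k]mulr_natl -mulrN ler_wpM2l // lerNr; exact: ln1B_le.
rewrite -natr1 mulrDl mul1r addrC /Phi lerD // ler_pdivlMr //.
apply: le_trans (ln_mul_ln_le (u := u) _); last by apply/andP; split; lra.
by rewrite mulrAC -[leRHS]mulrNN ler_wpM2r.
Qed.

End Analytic.

(** * Lower bound *)

Section TestingCost.
Variables (R : realType) (N : nat) (p : R).

Lemma Tbar_le M (C : 'M[bool]_(N, M)) : (0 < M <= N)%N -> Tbar N p <= Tavg p C.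
Proof.
case: M C => // k C /= kN.
apply: le_trans (bigmin_le _ (Ordinal kN) _) _.
exact: (bigmin_le _ C).
Qed.

Lemma Tmin_M_attained M : exists C : 'M[bool]_(N, M), Tmin_M N M p = Tavg p C.
Proof.
rewrite /Tmin_M; elim/big_ind: _ => [|x y [C ->] [D ->]|C _]; first by eexists.
  by rewrite minEle; case: ifP => _; eexists.
by eexists.
Qed.

Lemma Tbar_attained : (0 < N)%N ->
  exists M (C : 'M[bool]_(N, M)), (0 < M <= N)%N /\ Tbar N p = Tavg p C.
Proof.
move=> N0; rewrite /Tbar; elim/big_ind: _ => [|x y Hx Hy|k _].
- by have [C ->] := Tmin_M_attained 1; exists 1%N, C.
- by rewrite minEle; case: ifP.
- by have [C ->] := Tmin_M_attained k.+1; exists k.+1, C; split; rewrite //= ltn_ord.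
Qed.

Hypothesis p01 : 0 < p < 1.
Let p0 : 0 < p. Proof. by case/andP: p01. Qed.
Let p1 : p < 1. Proof. by case/andP: p01. Qed.
Let p01W : 0 <= p <= 1. Proof. by rewrite !ltW. Qed.

(** One empty pool costs 1, and [U0] and [U1] are disjoint. This crude bound serves when the line
    design has too many tests, and for the remainder block in the limit over [N]. *)
Lemma Tbar_le_succ : (0 < N)%N -> Tbar N p <= N.+1%:R.
Proof.
move=> N0; pose C : 'M[bool]_(N, 1) := const_mx false.
apply: le_trans (@Tbar_le 1 C _) _ => //.
rewrite -[leRHS](expect_cst N p).
apply: (@le_expect _ _ _ p01W (fun X => (Tcost X C)%:R)) => X.
rewrite ler_nat /Tcost -addnA leq_add2l -cardsUI.
rewrite (_ : U0 X C :&: U1 X C = finset.set0)%SET ?cards0 ?addn0; last first.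
  by apply/finset.setP => i; rewrite !inE; case: (X i); rewrite ?andbF.
by rewrite -[leqRHS](card_ord N) max_card.
Qed.

(* The weight of a singleton pool is set to Phi so that pool_cost holds for every pool size. *)
Let w (n : nat) : R := if n == 1%N then Phi p else - ln (1 - (1 - p) ^+ n.-1).

Let w_ge0 n : 0 <= w n.
Proof.
rewrite /w; case: eqP => _; first exact/ltW/Phi_gt0.
by rewrite oppr_ge0 ln_le0 // gerBl exprn_ge0 // subr_ge0 ltW.
Qed.

Let w_le n : n%:R * w n <= Phi p.
Proof.
case: n => [|[|n]]; first by rewrite mul0r ltW ?Phi_gt0.
  by rewrite /w /= mul1r.
by rewrite /w /=; apply: pool_cost.
Qed.

(** If [s] is the total weight of the pools of an item, the tangent to the exponential gives [(1 -
    p) * expR (- s) >= (1 + s0 - s) / Phi p]. In the sum over items each pool then takes away at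
    most 1, the price of its test. *)
Lemma Tavg_ge M (C : 'M[bool]_(N, M)) :
  N%:R * (1 + ln ((1 - p) * Phi p)) / Phi p <= Tavg p C.
Proof.
case/andP: (p01) => p_gt0 p_lt1; have P0 := Phi_gt0 p01.
have q0 : 0 < 1 - p by lra.
have qP : 0 < (1 - p) * Phi p by rewrite mulr_gt0.
set s0 := ln _.
have s01 : (1 + s0) / Phi p <= 1.
  rewrite ler_pdivrMr // mul1r.
  have := @le_ln1Dx R ((1 - p) * Phi p - 1); rewrite subrKC -/s0 => h.
  have : s0 <= (1 - p) * Phi p - 1 by apply: h; rewrite ltrBrDl subrr.
  have : 0 < p * Phi p by rewrite mulr_gt0.
  lra.
have U0_ge i : (1 + s0) / Phi p - (\sum_(a | C i a) w #|pool C a|) / Phi p <=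
    expect p (fun X => (i \in U0 X C)%:R).
  apply: le_trans (expect_U0_ge C p01W i).
  (* If [i] is alone in a pool, the product has a zero factor and has no logarithm; but the weight
     [Phi p] of that pool makes the left side nonpositive, by [s01]. *)
  have [/existsP[a /andP[Cia /eqP a1]]|] := boolP [exists a, C i a && (#|pool C a| == 1%N)].
    apply: (@le_trans _ _ 0); last first.
      rewrite mulr_ge0 ?(ltW q0) //; apply: prodr_ge0 => b _.
      by rewrite subr_ge0 exprn_ile1 //; lra.
    rewrite (bigD1 a) //= {1}/w a1 eqxx [(Phi p + _) / _]mulrDl divff ?gt_eqF //.
    have : 0 <= (\sum_(b | C i b && (b != a)) w #|pool C b|) / Phi p.
      by rewrite divr_ge0 ?(ltW P0) //; apply: sumr_ge0.
    lra.
  rewrite negb_exists => /forallP nsing.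
  set s := \sum_(a | _) _.
  have -> : \prod_(a | C i a) (1 - (1 - p) ^+ #|pool C a|.-1) = expR (- s).
    rewrite /s -sumrN expR_sum; apply: eq_bigr => a Cia.
    have := nsing a; rewrite Cia /= /w => /negPf h; rewrite h opprK lnK // posrE.
    rewrite subr_gt0 exprn_ilt1 ?(ltW q0) //; last lra.
    by move: h; rewrite (cardsD1 i (pool C a)) mem_pool Cia add1n; case: #|_|.
  rewrite -mulrBl ler_pdivrMr // mulrAC -[X in X * expR _]lnK // -expRD -/s0.
  by have := expR_ge1Dx (s0 - s); rewrite addrA.
rewrite TavgE -[leLHS]addr0 lerD ?expect_U1_ge0 //.
have /le_trans -> // : N%:R * (1 + s0) / Phi p <= M%:R +
    \sum_(i < N) ((1 + s0) / Phi p - (\sum_(a | C i a) w #|pool C a|) / Phi p).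
  rewrite big_split /= sumr_const card_ord -[X in _ + (X + _)]mulr_natl mulrA.
  rewrite addrCA lerDl sumrN subr_ge0 -mulr_suml ler_pdivrMr //.
  (* Summed by pools, [a] contributes its size times its weight, at most [Phi p] by [w_le]. *)
  rewrite (exchange_big_dep predT) //=.
  rewrite -[X in X%:R * _](card_ord M) mulr_natl -sumr_const.
  apply: ler_sum => a _; rewrite sumr_const -mulr_natl.
  by rewrite (_ : #|_| = #|pool C a|) //; apply: eq_card => i; rewrite !inE.
by rewrite lerD2l ler_sum.
Qed.

Lemma Tbar_ge : (0 < N)%N -> N%:R * (1 + ln ((1 - p) * Phi p)) / Phi p <= Tbar N p.
Proof. by move=> /Tbar_attained[M [C [_ ->]]]; apply: Tavg_ge. Qed.

End TestingCost.

(** * Line design *)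

Section LineDesign.
Variables (N n L : nat).
Let m := n.+1.
(** Number of intercepts reserved for each slope: [y <= N %/ m] and [a x <= L m], so every line
    through a grid point gets a column. *)
Let W := (N %/ m + 1 + L * m)%N.

(* Variable i is the grid point (x, y) = (i %% m, i %/ m) and column c encodes
   the line y + a x = b with a = c %/ W < L and b = c %% W. *)
Definition line_design : 'M[bool]_(N, L * W) :=
  \matrix_(i, c) (i %/ m + (c %/ W) * (i %% m) == c %% W)%N.

Let W_gt0 : (0 < W)%N. Proof. by rewrite /W addn1. Qed.

(** Each slope gives one line through the point, and division of the column by [W] recovers the
    slope, so these [L] columns are distinct. *)
Lemma line_design_degree i : (L <= #|[pred c | line_design i c]|)%N.
Proof.
pose b (a : 'I_L) := (i %/ m + a * (i %% m))%N.
have bW a : (b a < W)%N.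
  rewrite /b /W -addnA -addnS leq_add ?leq_div2r ?(ltnW (ltn_ord i)) // add1n ltnS.
  by rewrite leq_mul ?(ltnW (ltn_ord a)) // ltnW // ltn_pmod.
have fP (a : 'I_L) : (a * W + b a < L * W)%N.
  by rewrite (@leq_trans (a.+1 * W)) // ?leq_mul2r ?ltn_ord ?orbT // mulSn addnC ltn_add2r.
pose f a := Ordinal (fP a).
have fdiv a : (f a %/ W = a)%N by rewrite /= divnMDl // divn_small // addn0.
have fmod a : (f a %% W = b a)%N by rewrite /= modnMDl modn_small.
have finj : injective f by move=> a a' /(congr1 (fun c : 'I__ => c %/ W)%N); rewrite !fdiv => /val_inj.
rewrite -[X in (X <= _)%N](card_ord L) -(card_codom finj).
apply/subset_leq_card/fintype.subsetP => c /codomP[a ->].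
by rewrite inE mxE fdiv fmod.
Qed.

(** A line has at most one point over each of the [n.+1] abscissae. *)
Lemma line_design_pool_size c : (#|pool line_design c| <= n.+1)%N.
Proof.
pose g (j : 'I_N) : 'I_m := Ordinal (ltn_pmod j (isT : (0 < m)%N)).
rewrite -(@card_in_imset _ _ g).
  by rewrite -[leqRHS](card_ord n.+1) max_card.
move=> i j; rewrite !inE !mxE => /eqP hi /eqP hj /(congr1 val) /= e.
have {}hi : (i %/ m + (c %/ W) * (i %% m) = j %/ m + (c %/ W) * (i %% m))%N by rewrite hi -hj e.
move/addIn: hi => d.
by apply: val_inj; rewrite /= (divn_eq i m) (divn_eq j m) d e.
Qed.

Lemma line_design_meet i j a b :
  line_design i a -> line_design i b -> line_design j a -> line_design j b ->
  a != b -> j = i.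
Proof.
rewrite !mxE => /eqP ia /eqP ib /eqP ja /eqP jb ab.
(* Lines of equal slope through a common point have equal intercepts, hence the same column. *)
have slope : (a %/ W)%N != (b %/ W)%N.
  apply: contra ab => /eqP e; apply/eqP/val_inj => /=.
  by rewrite (divn_eq a W) (divn_eq b W) -ia -ib e.
move: ia ib ja jb slope; set da := (a %/ W)%N; set db := (b %/ W)%N.
move: (a %% W)%N (b %% W)%N => ra rb ia ib ja jb slope.
have [xe ye] : (j %% m = i %% m /\ j %/ m = i %/ m)%N.
  move: ia ib ja jb slope; move: (i %% m)%N (i %/ m)%N (j %% m)%N (j %/ m)%N da db => x y x' y' s t *.
  (* Subtracting the line equations gives [(s - t) (x - x') = 0] with [s] and [t] distinct. *)
  suff xe : x' = x by split=> //; subst; lia.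
  nia.
by apply: val_inj; rewrite /= (divn_eq i m) (divn_eq j m) xe ye.
Qed.

Variables (R : realType) (p : R).
Hypothesis p01 : 0 < p < 1.

Lemma Tbar_le_design : (0 < N)%N -> (0 < L)%N ->
  Tbar N p <= (L * (N %/ n.+1 + 1 + L * n.+1))%:R +
    N%:R * (1 - (1 - p) ^+ n) ^+ L + N%:R * p.
Proof.
move=> N0 L0; case/andP: (p01) => p0 p1.
have p01W : 0 <= p <= 1 by rewrite !ltW.
have q0 : 0 <= 1 - p by rewrite subr_ge0 ltW.
(* [Tbar] allows at most [N] tests. If the design has more, then [N + 1 <= L * W] and the crude
   bound suffices. *)
have [LN|LN] := leqP (L * W) N.
  apply: le_trans (Tbar_le p line_design _) _; first by rewrite LN muln_gt0 L0 W_gt0.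
  rewrite TavgE lerD ?expect_U1_le // lerD2l.
  rewrite -[X in X%:R * _](card_ord N) mulr_natl -sumr_const ler_sum // => i _.
  apply: expect_U0_le => //; first exact: line_design_degree.
    by move=> c _; exact: line_design_pool_size.
  by move=> a b j *; apply: (@line_design_meet i j a b).
apply: le_trans (Tbar_le_succ p01 N0) _.
rewrite -addrA -[leLHS]addr0 lerD ?ler_nat // addr_ge0 //.
  rewrite mulr_ge0 // exprn_ge0 // subr_ge0 exprn_ile1 //; lra.
by rewrite mulr_ge0 // ltW.
Qed.

End LineDesign.

(** * Subadditivity *)

Section Subadditivity.
Variables (N1 N2 M1 M2 : nat) (C1 : 'M[bool]_(N1, M1)) (C2 : 'M[bool]_(N2, M2)).
Local Notation config n := {ffun 'I_n -> bool}.

(** Two designs side by side: the zero blocks keep the tests of each group blind to the other, so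
    outcomes, sure items and costs all restrict to the groups. *)
Let C := block_mx C1 (const_mx false) (const_mx false) C2.

Definition lconfig (X : config (N1 + N2)) : config N1 := [ffun i => X (lshift N2 i)].
Definition rconfig (X : config (N1 + N2)) : config N2 := [ffun i => X (rshift N1 i)].

Lemma exists_split_ord n1 n2 (P : pred 'I_(n1 + n2)) :
  [exists i, P i] = [exists i, P (lshift n2 i)] || [exists i, P (rshift n1 i)].
Proof.
apply/existsP/orP => [[i]|[] /existsP[i Pi]]; try by eexists; exact: Pi.
by case: (split_ordP i) => j -> Pj; [left|right]; apply/existsP; exists j.
Qed.

Lemma forall_split_ord n1 n2 (P : pred 'I_(n1 + n2)) :
  [forall i, P i] = [forall i, P (lshift n2 i)] && [forall i, P (rshift n1 i)].
Proof.
apply/forallP/andP => [H|[/forallP Hl /forallP Hr] i].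
  by split; apply/forallP => i; apply: H.
by case: (split_ordP i) => j ->.
Qed.

Let exists_false (T : finType) : [exists i : T, false] = false.
Proof. by apply/existsP => -[]. Qed.

Let forall_true (T : finType) : [forall i : T, true] = true.
Proof. exact/forallP. Qed.

Lemma test_outcome_l X a : test_outcome X C (lshift M2 a) = test_outcome (lconfig X) C1 a.
Proof.
rewrite /test_outcome exists_split_ord.
under eq_existsb do rewrite block_mxEul.
under [X in _ || X]eq_existsb do rewrite block_mxEdl mxE /=.
rewrite exists_false orbF; apply: eq_existsb => j; by rewrite ffunE.
Qed.

Lemma test_outcome_r X a : test_outcome X C (rshift M1 a) = test_outcome (rconfig X) C2 a.
Proof.
rewrite /test_outcome exists_split_ord.
under eq_existsb do rewrite block_mxEur mxE /=.
under [X in _ || X]eq_existsb do rewrite block_mxEdr.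
rewrite exists_false /=; apply: eq_existsb => j; by rewrite ffunE.
Qed.

Lemma sure_zero_l X i : sure_zero X C (lshift N2 i) = sure_zero (lconfig X) C1 i.
Proof.
rewrite /sure_zero exists_split_ord.
under eq_existsb do rewrite block_mxEul test_outcome_l.
under [X in _ || X]eq_existsb do rewrite block_mxEur mxE /=.
by rewrite exists_false orbF.
Qed.

Lemma sure_zero_r X i : sure_zero X C (rshift N1 i) = sure_zero (rconfig X) C2 i.
Proof.
rewrite /sure_zero exists_split_ord.
under eq_existsb do rewrite block_mxEdl mxE /=.
under [X in _ || X]eq_existsb do rewrite block_mxEdr test_outcome_r.
by rewrite exists_false.
Qed.

Lemma sure_one_l X i : sure_one X C (lshift N2 i) = sure_one (lconfig X) C1 i.
Proof.
rewrite /sure_one ffunE exists_split_ord; congr (_ && _).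
under [X in _ || X]eq_existsb do rewrite block_mxEur mxE /=.
rewrite exists_false orbF; apply: eq_existsb => a; rewrite block_mxEul; congr (_ && _).
rewrite forall_split_ord.
under [X in _ && X]eq_forallb do rewrite block_mxEdl mxE andbF /=.
rewrite forall_true andbT; apply: eq_forallb => j.
by rewrite block_mxEul sure_zero_l (inj_eq (@lshift_inj _ _)).
Qed.

Lemma sure_one_r X i : sure_one X C (rshift N1 i) = sure_one (rconfig X) C2 i.
Proof.
rewrite /sure_one ffunE exists_split_ord; congr (_ && _).
under eq_existsb do rewrite block_mxEdl mxE /=.
rewrite exists_false /=; apply: eq_existsb => a; rewrite block_mxEdr; congr (_ && _).
rewrite forall_split_ord.
under eq_forallb do rewrite block_mxEur mxE andbF /=.
rewrite forall_true /=; apply: eq_forallb => j.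
by rewrite block_mxEdr sure_zero_r (inj_eq (@rshift_inj _ _)).
Qed.

Lemma card_split_ord n1 n2 (A : {set 'I_(n1 + n2)}) (A1 : {set 'I_n1}) (A2 : {set 'I_n2}) :
  (forall i, (lshift n2 i \in A) = (i \in A1)) -> (forall i, (rshift n1 i \in A) = (i \in A2)) ->
  #|A| = (#|A1| + #|A2|)%N.
Proof.
move=> H1 H2; rewrite -!sum1_card [LHS]big_mkcond big_split_ord /=.
by congr (_ + _)%N; rewrite [RHS]big_mkcond; apply: eq_bigr => i _; rewrite ?H1 ?H2.
Qed.

Lemma Tcost_block X : Tcost X C = (Tcost (lconfig X) C1 + Tcost (rconfig X) C2)%N.
Proof.
rewrite /Tcost (@card_split_ord _ _ (U0 X C) (U0 (lconfig X) C1) (U0 (rconfig X) C2)).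
- rewrite (@card_split_ord _ _ (U1 X C) (U1 (lconfig X) C1) (U1 (rconfig X) C2)).
  + by lia.
  + by move=> i; rewrite !inE sure_one_l ffunE.
  + by move=> i; rewrite !inE sure_one_r ffunE.
- by move=> i; rewrite !inE sure_zero_l ffunE.
- by move=> i; rewrite !inE sure_zero_r ffunE.
Qed.

Variables (R : realType) (p : R).

(** Under [join] the measure is a product, and each of the two costs depends on one half only, so
    the other half sums to 1. *)
Lemma Tavg_block : Tavg p C = Tavg p C1 + Tavg p C2.
Proof.
pose join (Y : config N1 * config N2) : config (N1 + N2) :=
  [ffun i : 'I_(N1 + N2) => match fintype.split i with inl j => Y.1 j | inr j => Y.2 j end].
have lj Y : lconfig (join Y) = Y.1.
  apply/ffunP => i; rewrite !ffunE; case: splitP => j /= e; first by congr (Y.1 _); apply: val_inj.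
  by have := ltn_ord i; rewrite e ltnNge leq_addr.
have rj Y : rconfig (join Y) = Y.2.
  apply/ffunP => i; rewrite !ffunE; case: splitP => j /= e.
    by have := ltn_ord j; rewrite -e ltnNge leq_addr.
  by congr (Y.2 _); apply: val_inj; move/addnI: e.
rewrite /Tavg (reindex join) /=; last first.
  exists (fun X => (lconfig X, rconfig X)) => [Y _|X _]; first by rewrite lj rj -surjective_pairing.
  by apply/ffunP => i; rewrite ffunE; case: splitP => j /= e; rewrite ffunE; congr (X _); apply: val_inj.
have muj Y : mu p (join Y) = mu p Y.1 * mu p Y.2.
  rewrite /mu big_split_ord /=; congr (_ * _); apply: eq_bigr => i _.
    by have /ffunP/(_ i) := lj Y; rewrite {1}/lconfig ffunE => ->.
  by have /ffunP/(_ i) := rj Y; rewrite {1}/rconfig ffunE => ->.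
under eq_bigr do rewrite Tcost_block lj rj natrD mulrDr muj.
rewrite big_split /=; congr (_ + _).
  rewrite -(pair_bigA _ (fun X Y => mu p X * mu p Y * (Tcost X C1)%:R)) /=.
  by apply: eq_bigr => X _; rewrite -mulr_suml -mulr_sumr mu_sum mulr1.
rewrite -(pair_bigA _ (fun X Y => mu p X * mu p Y * (Tcost Y C2)%:R)) /=.
rewrite exchange_big; apply: eq_bigr => Y _.
by rewrite -!mulr_suml mu_sum mul1r.
Qed.

End Subadditivity.

Lemma Tbar_subadditive (R : realType) (p : R) (N1 N2 : nat) : (0 < N1)%N -> (0 < N2)%N ->
  Tbar (N1 + N2) p <= Tbar N1 p + Tbar N2 p.
Proof.
move=> /(Tbar_attained p)[M1 [C1 [/andP[M10 M1N] ->]]] /(Tbar_attained p)[M2 [C2 [/andP[M20 M2N] ->]]].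
by rewrite -Tavg_block; apply: Tbar_le; rewrite addn_gt0 M10 leq_add.
Qed.

Lemma Tbar_mulD_le (R : realType) (p : R) (n k r : nat) : (0 < n)%N -> (0 < r)%N ->
  Tbar (k * n + r) p <= k%:R * Tbar n p + Tbar r p.
Proof.
move=> n0 r0; elim: k => [|k IH]; first by rewrite mul0n mul0r add0r.
rewrite mulSn -addnA -natr1 mulrDl mul1r [_ * _ + _]addrC -addrA.
apply: le_trans (Tbar_subadditive p n0 _) _; first by rewrite addn_gt0 r0 orbT.
by rewrite lerD2l.
Qed.

(** * Explicit bounds *)

Section RatioBounds.
Variable R : realType.
Implicit Types (p : R) (N : nat).

Definition cost_ratio N p : R := Tbar N p / (N%:R * p * `|ln p|).

(** The bound of [Tbar_ge] over [N p |ln p|]. Splitting [ln ((1 - p) * Phi p)] as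
    [ln ((1 - p) * (Phi p * p)) - ln p] isolates the divergent logarithm. *)
Definition ratio_lower p : R :=
  ((1 + ln ((1 - p) * (Phi p * p))) * (- ln p)^-1 + 1) / (Phi p * p).

(** The first product bounds the main term [L * (N %/ n.+1)] of the number of tests; the last term
    collects undetected zeros and undetected ones, each at most [N p]. *)
Definition ratio_upper p : R :=
  ((ln 2)^-1 + (- ln p)^-1) * (- ln (1 - p) / p / ln 2) + 2 * (- ln p)^-1.

Lemma ln2_ge : 2^-1 <= ln 2 :> R.
Proof.
have := @ln1B_le R 2^-1; rewrite (_ : 1 - 2^-1 = 2^-1); last by field.
by rewrite lnV ?posrE // lerN2; apply; rewrite invf_lt1 // ltr1n.
Qed.

Lemma ln2_le1 : ln 2 <= 1 :> R.
Proof. by apply: (@le_ln1Dx R 1); rewrite (@lt_trans _ _ 0) ?ltrN10 ?ltr01. Qed.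

Lemma normr_ln p : 0 < p < 1 -> `|ln p| = - ln p.
Proof. by move=> /ln_lt0/ltr0_norm. Qed.

Lemma ratio_ge N p : 0 < p < 1 -> (0 < N)%N -> ratio_lower p <= cost_ratio N p.
Proof.
move=> p01 N0; case/andP: (p01) => p0 p1.
have l0 : 0 < - ln p by rewrite oppr_gt0 ln_lt0.
have P0 := Phi_gt0 p01.
have N0' : 0 < N%:R :> R by rewrite ltr0n.
have q0 : 0 < 1 - p by rewrite subr_gt0.
rewrite /cost_ratio normr_ln // ler_pdivlMr ?mulr_gt0 //.
apply: le_trans (Tbar_ge p01 N0); rewrite /ratio_lower.
rewrite [(1 - p) * (_ * p)]mulrA [ln (_ * p)]lnM ?posrE ?mulr_gt0 //.
rewrite le_eqVlt; apply/orP; left; apply/eqP.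
have lp0 : ln p != 0 by rewrite lt_eqF // ln_lt0.
by field; rewrite lp0 !gt_eqF.
Qed.

Lemma ratio_le N p : 0 < p <= 2^-1 -> (0 < N)%N ->
  cost_ratio N p <= ratio_upper p + 36 * (- ln p) / p ^+ 2 / N%:R.
Proof.
move=> /andP[p0 p2] N0.
have c2 := ln2_ge; have c1 := ln2_le1.
have h2 : (2^-1 : R) < 1 by rewrite invf_lt1 // ltr1n.
have p1 : p < 1 by lra.
have p01 : 0 < p < 1 by rewrite p0.
have N0' : 0 < N%:R :> R by rewrite ltr0n.
have q0 : 0 < 1 - p by lra.
have dp : p <= - ln (1 - p) by rewrite lerNr ln1B_le.
have lc : ln 2 <= - ln p.
  by rewrite lerNr -lnV ?posrE // ler_ln ?posrE ?invr_gt0.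
rewrite /cost_ratio normr_ln // /ratio_upper.
set l := - ln p in lc *; set d := - ln (1 - p) in dp *.
set c : R := ln 2 in c1 c2 lc *.
have c0 : 0 < c by lra.
have d0 : 0 < d by lra.
have l0 : 0 < l by lra.
(* The largest [n] with [(1 - p) ^+ n >= 1/2]: the other members of a pool hit it with probability
   at most [1/2]. *)
have [n /andP[n_le n_gt]] : exists n, n%:R <= c / d < n.+1%:R.
  by exists (Num.truncn (c / d)); apply: truncn_itv; rewrite divr_ge0 ?ltW.
(* Enough slopes to have [2^-1 ^+ L <= p]. *)
have [L [L0 L_le L_gt]] : exists L, [/\ (0 < L)%N, L%:R <= l / c + 1 & l / c < L%:R].
  have /andP[h h'] : (Num.truncn (l / c))%:R <= l / c < (Num.truncn (l / c)).+1%:R.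
    by apply: truncn_itv; rewrite divr_ge0 ?ltW.
  by exists (Num.truncn (l / c)).+1; split; rewrite // -natr1 lerD2r.
have half : 1 - (1 - p) ^+ n <= 2^-1.
  have : 2^-1 <= (1 - p) ^+ n.
    rewrite -ler_ln ?posrE ?exprn_gt0 ?invr_gt0 // lnV ?posrE // lnXn //.
    rewrite -/c lerNl -mulNrn -/d -mulr_natl.
    by rewrite -ler_pdivlMr.
  lra.
have Lp : (1 - (1 - p) ^+ n) ^+ L <= p.
  apply: (@le_trans _ _ (2^-1 ^+ L)).
    by rewrite lerXn2r ?nnegrE ?invr_ge0 // subr_ge0 exprn_ile1; lra.
  rewrite -ler_ln ?posrE ?exprn_gt0 ?invr_gt0 // lnXn ?invr_gt0 // lnV ?posrE //.
  rewrite -/c mulNrn lerNl -/l -mulr_natr -ler_pdivrMl //.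
  by rewrite mulrC ltW.
rewrite ler_pdivrMr ?mulr_gt0 //.
apply: le_trans (Tbar_le_design n p01 N0 L0) _.
have m_le : n.+1%:R <= 2 / p.
  rewrite -natr1 ler_pdivlMr // mulrDl mul1r.
  have : n%:R * p <= c.
    apply: (@le_trans _ _ (n%:R * d)); first by rewrite ler_wpM2l.
    by rewrite -ler_pdivlMr.
  lra.
have L4 : L%:R <= 4 * l.
  apply: le_trans L_le _; apply: (@le_trans _ _ (2 * (l / c))).
    have : 1 <= l / c by rewrite ler_pdivlMr // mul1r.
    lra.
  rewrite mulrA ler_pdivrMr //; nra.
have main : L%:R * (N %/ n.+1)%:R <= N%:R * ((l / c + 1) * (d / c)).
  have Nm : (N %/ n.+1)%:R <= N%:R * (d / c).
    apply: (@le_trans _ _ (N%:R / n.+1%:R)).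
      by rewrite ler_pdivlMr ?ltr0n // -natrM ler_nat leq_divM.
    rewrite ler_wpM2l // -[leRHS]invf_div lef_pV2 ?posrE ?divr_gt0 ?ltr0n //.
    exact: ltW.
  apply: (@le_trans _ _ ((l / c + 1) * (N%:R * (d / c)))); last by rewrite mulrCA.
  by rewrite ler_pM.
(* Boundary tests: [L <= 4 l], [L * n.+1 <= 8 l / p] and [1 <= l / p], whence 36 = 4 (1 + 8). *)
have rest : L%:R * (1 + L%:R * n.+1%:R) <= 36 * l ^+ 2 / p.
  have lp : 1 <= l / p by rewrite ler_pdivlMr // mul1r; lra.
  have Lm : L%:R * n.+1%:R <= 8 * (l / p).
    apply: (@le_trans _ _ (4 * l * (2 / p))); first by rewrite ler_pM.
    by rewrite le_eqVlt; apply/orP; left; apply/eqP; field; rewrite gt_eqF.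
  apply: (@le_trans _ _ (4 * l * (9 * (l / p)))).
    by rewrite ler_pM //; lra.
  by rewrite le_eqVlt; apply/orP; left; apply/eqP; field; rewrite gt_eqF.
have U0b : N%:R * (1 - (1 - p) ^+ n) ^+ L <= N%:R * p by rewrite ler_wpM2l.
have -> : (L * (N %/ n.+1 + 1 + L * n.+1))%:R =
    L%:R * (N %/ n.+1)%:R + L%:R * (1 + L%:R * n.+1%:R) :> R.
  by rewrite natrM !natrD natrM; ring.
have -> : ((c^-1 + l^-1) * (d / p / c) + 2 * l^-1 + 36 * l / p ^+ 2 / N%:R) * (N%:R * p * l) =
   N%:R * ((l / c + 1) * (d / c)) + 36 * l ^+ 2 / p + N%:R * p + N%:R * p.
  by field; rewrite !gt_eqF.
by rewrite !lerD.
Qed.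
End RatioBounds.

(** * Limits *)

Local Open Scope classical_set_scope.

Section Limits.
Variable R : realType.
Implicit Types (p : R) (N : nat).

(** * Limits as [p] tends to 0 from the right *)

Lemma near_at_right0 : \forall p \near (0 : R)^'+, 0 < p <= 2^-1.
Proof.
near=> p; apply/andP; split; first by near: p; exact: nbhs_right_gt.
by near: p; apply: nbhs_right_le; rewrite invr_gt0.
Unshelve. all: by end_near. Qed.

Lemma cvg_id_at_right0 : p @[p --> (0 : R)^'+] --> (0 : R).
Proof. by apply: cvg_at_right_filter; exact: cvg_id. Qed.

Lemma cvg_1B : (1 - p) @[p --> (0 : R)^'+] --> (1 : R).
Proof.
have H := @cvgB _ _ _ _ _ _ _ _ _ (cvg_cst (1 : R)) cvg_id_at_right0.
by move: H; rewrite subr0 => H; apply: H.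
Qed.

Lemma cvg_lnV0 : (- ln p)^-1 @[p --> (0 : R)^'+] --> (0 : R).
Proof.
apply/gtr0_cvgV0.
  near=> p; have /andP[p0 p2] : 0 < p <= 2^-1 by near: p; exact: near_at_right0.
  by rewrite oppr_gt0 ln_lt0 // p0 (le_lt_trans p2) // invf_lt1 // ltr1n.
by apply/cvgNry; exact: lnNy.
Unshelve. all: by end_near. Qed.

(** The inequality [ln x < x] at the inverse square root of [p] bounds [- ln p] times the square
    root of [p] by 2. *)
Lemma cvg_mul_ln0 : - ln p * p @[p --> (0 : R)^'+] --> (0 : R).
Proof.
apply: (@squeeze_cvgr _ _ _ _ (fun=> 0) (fun p => 2 * p `^ 2^-1)).
- near=> p; have /andP[p0 p2] : 0 < p <= 2^-1 by near: p; exact: near_at_right0.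
  have h2 : (2^-1 : R) < 1 by rewrite invf_lt1 // ltr1n.
  have l0 : 0 < - ln p by rewrite oppr_gt0 ln_lt0 // p0 (le_lt_trans p2).
  rewrite (mulr_ge0 (ltW l0) (ltW p0)) /=.
  have s0 : 0 < p `^ 2^-1 by rewrite powR_gt0.
  have ss : p = p `^ 2^-1 * p `^ 2^-1.
    rewrite -powRD ?(gt_eqF p0) ?implybT // (_ : 2^-1 + 2^-1 = 1); last by field.
    by rewrite powRr1 // ltW.
  have := @ln_sublinear R (p `^ 2^-1)^-1; rewrite invr_gt0 => /(_ s0).
  rewrite lnV ?posrE // ln_powR => h.
  have {}h : - ln p * p `^ 2^-1 < 2.
    rewrite -ltr_pdivlMr // -ltr_pdivrMl //.
    by rewrite mulrN.
  apply: (@le_trans _ _ (- ln p * p `^ 2^-1 * p `^ 2^-1)); first by rewrite -mulrA -ss.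
  by rewrite ler_wpM2r ?ltW.
- exact: cvg_cst.
- rewrite -[X in _ --> X](mulr0 2); apply: cvgM; first exact: cvg_cst.
  by apply: powR_cvg0; rewrite invr_gt0.
Unshelve. all: by end_near. Qed.

Lemma cvg_Phi_mul : Phi p * p @[p --> (0 : R)^'+] --> (ln 2 ^+ 2 : R).
Proof.
apply: (@cvg_trans _ ((- ln p * p + ln 2 ^+ 2) @[p --> (0 : R)^'+])).
  apply: near_eq_cvg; near=> p.
  have /andP[p0 _] : 0 < p <= 2^-1 by near: p; exact: near_at_right0.
  by rewrite /Phi; field; rewrite gt_eqF.
have := cvgD cvg_mul_ln0 (cvg_cst (ln 2 ^+ 2 : R)).
by rewrite add0r => H; apply: H.
Unshelve. all: by end_near. Qed.

Let c0 : 0 < ln 2 :> R. Proof. by rewrite ln_gt0 // ltr1n. Qed.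

Lemma cvg_ratio_lower : ratio_lower p @[p --> (0 : R)^'+] --> ((ln 2 ^+ 2)^-1 : R).
Proof.
have cc : 0 < ln 2 ^+ 2 :> R by rewrite exprn_gt0.
rewrite -[X in _ --> X]mul1r; apply: cvgM; last first.
  by apply: cvgV; [rewrite gt_eqF|exact: cvg_Phi_mul].
rewrite -[X in _ --> X]add0r; apply: cvgD; last exact: cvg_cst.
rewrite -[X in _ --> X](mulr0 (1 + ln (1 * ln 2 ^+ 2))); apply: cvgM; last exact: cvg_lnV0.
apply: cvgD; first exact: cvg_cst.
apply: continuous_cvg; first by apply: continuous_ln; rewrite mul1r.
exact: cvgM cvg_1B cvg_Phi_mul.
Qed.

(** Squeezed by [p <= - ln (1 - p) <= p / (1 - p)]; both sides come from [ln (1 + x) <= x]. *)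
Lemma cvg_ln1B_div : - ln (1 - p) / p @[p --> (0 : R)^'+] --> (1 : R).
Proof.
apply: (@squeeze_cvgr _ _ _ _ (fun=> 1) (fun p => (1 - p)^-1)).
- near=> p; have /andP[p0 p2] : 0 < p <= 2^-1 by near: p; exact: near_at_right0.
  have h2 : (2^-1 : R) < 1 by rewrite invf_lt1 // ltr1n.
  have q0 : 0 < 1 - p by lra.
  rewrite ler_pdivlMr // mul1r lerNr ln1B_le /=; last by lra.
  rewrite ler_pdivrMr // -lnV ?posrE // [leRHS]mulrC.
  have := @le_ln1Dx R (p / (1 - p)).
  rewrite (_ : 1 + p / (1 - p) = (1 - p)^-1); last by field; rewrite gt_eqF.
  by apply; rewrite (@lt_trans _ _ 0) ?ltrN10 ?divr_gt0.
- exact: cvg_cst.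
- rewrite -[X in _ --> X]invr1; apply: cvgV; first exact: oner_neq0.
  exact: cvg_1B.
Unshelve. all: by end_near. Qed.

Lemma cvg_ratio_upper : ratio_upper p @[p --> (0 : R)^'+] --> ((ln 2 ^+ 2)^-1 : R).
Proof.
rewrite (_ : (ln 2 ^+ 2)^-1 = ((ln 2)^-1 + 0) * (1 / ln 2) + 2 * 0 :> R); last first.
  by field; rewrite gt_eqF.
apply: cvgD; last by apply: cvgM; [exact: cvg_cst|exact: cvg_lnV0].
apply: cvgM; first by apply: cvgD; [exact: cvg_cst|exact: cvg_lnV0].
by apply: cvgM; [exact: cvg_ln1B_div|exact: cvg_cst].
Qed.

(** * Limits as the number of items grows *)

Lemma cvg_invn : (n.+1%:R^-1 : R) @[n --> \oo] --> (0 : R).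
Proof. exact: cvg_harmonic. Qed.

Lemma cvg_powRN (a : R) : 0 < a -> (n.+1%:R `^ (- a) : R) @[n --> \oo] --> (0 : R).
Proof.
move=> a0; have [/(_ (powR_cvg0 a0) harmonic) H _] := cvg_at_rightP (fun x : R => x `^ a) 0 0.
under eq_fun do rewrite -mulN1r powRrM powR_inv1 ?ler0n //.
by apply: H; split; [exact: harmonic_gt0|exact: cvg_harmonic].
Qed.

Lemma Tbar_ge0 N p : 0 < p < 1 -> (0 < N)%N -> 0 <= Tbar N p.
Proof.
move=> /andP[p0 p1] /(Tbar_attained p)[M [C [_ ->]]].
by apply: sumr_ge0 => X _; rewrite mulr_ge0 // mu_ge0 // !ltW.
Qed.

(* Fekete's argument *)
Lemma cvg_Tbar_div p : 0 < p < 1 ->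
  Tbar N p / N%:R @[N --> \oo] --> inf [set Tbar N.+1 p / N.+1%:R | N in setT].
Proof.
move=> p01; set E := [set _ | _ in _].
have E0 : lbound E 0 by move=> _ [n _ <-]; rewrite divr_ge0 // Tbar_ge0.
have hE : has_inf E by split; [exists (Tbar 1 p / 1%:R); exists 0%N|exists 0].
apply/cvgrPdist_le => e e0.
have e20 : 0 < e / 2 by rewrite divr_gt0.
have [_ [n _ <-] nlt] := inf_adherent e20 hE.
near=> N.
have nN : (n.+1 <= N)%N by near: N; exact: nbhs_infty_ge.
have N0 : (0 < N)%N by apply: leq_trans nN.
have N0' : 0 < N%:R :> R by rewrite ltr0n.
have lo : inf E <= Tbar N p / N%:R by apply: ge_inf; [exists 0|exists N.-1; rewrite ?prednK].
rewrite distrC ger0_norm ?subr_ge0 // lerBlDl.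
have Nbig : (2 * n.+1)%:R / N%:R <= e / 2.
  near: N.
  apply: (@cvgr_le _ _ _ _ (fun N => (2 * n.+1)%:R / N%:R) 0 _ (e / 2)) => //.
  rewrite -(mulr0 (2 * n.+1)%:R); apply: cvgM; first exact: cvg_cst.
  by rewrite -cvg_shiftS; exact: cvg_invn.
(* One full block is moved into the remainder to make [r] positive; [r] stays below [2 * n.+1], so
   its cost is bounded independently of [N]. *)
pose k := (N %/ n.+1).-1; pose r := (N %% n.+1 + n.+1)%N.
have Nkr : N = (k * n.+1 + r)%N.
  rewrite {1}(divn_eq N n.+1) -[(N %/ _)%N]prednK ?divn_gt0 // -/k mulSn /r.
  by rewrite -addnA addnC -addnA.
have r0 : (0 < r)%N by rewrite /r addnS.
have rle : (r.+1 <= 2 * n.+1)%N by rewrite /r -addSn mul2n -addnn leq_add2r ltn_pmod.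
have up : Tbar N p <= k%:R * Tbar n.+1 p + (2 * n.+1)%:R.
  rewrite {1}Nkr; apply: le_trans (Tbar_mulD_le p k (ltn0Sn n) r0) _.
  by rewrite lerD2l; apply: le_trans (Tbar_le_succ p01 r0) _; rewrite ler_nat.
have up2 : k%:R * Tbar n.+1 p <= N%:R * (Tbar n.+1 p / n.+1%:R).
  rewrite mulrCA mulrC ler_wpM2l ?Tbar_ge0 // ler_pdivlMr ?ltr0n // -natrM ler_nat.
  by rewrite [leqRHS]Nkr leq_addr.
rewrite ler_pdivrMr //; apply: le_trans up _.
move: Nbig; rewrite ler_pdivrMr // => Nbig.
apply: le_trans (lerD up2 Nbig) _; rewrite [e / 2 * _]mulrC -mulrDr mulrC ler_wpM2r //.
by rewrite [X in _ <= _ + X](splitr e) addrA lerD2r ltW.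
Unshelve. all: by end_near. Qed.

Lemma cvg_ratio_fixed p : 0 < p < 1 ->
  cost_ratio N p @[N --> \oo] -->
    inf [set Tbar N.+1 p / N.+1%:R | N in setT] / (p * `|ln p|).
Proof.
move=> p01.
have -> : (fun N => cost_ratio N p) = fun N => Tbar N p / N%:R * (p * `|ln p|)^-1.
  by apply/funext => N; rewrite /cost_ratio -[N%:R * p * _]mulrA invfM mulrA.
by apply: cvgM; [exact: cvg_Tbar_div|exact: cvg_cst].
Qed.

(** For fixed [p] the error term of [ratio_le] is of order [1 / N], so both explicit bounds pass to
    the limit. *)
Lemma inf_Tbar_div_bounds p : 0 < p <= 2^-1 ->
  ratio_lower p <= inf [set Tbar N.+1 p / N.+1%:R | N in setT] / (p * `|ln p|) <= ratio_upper p.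
Proof.
move=> p2; have p01 : 0 < p < 1.
  by case/andP: p2 => -> /le_lt_trans -> //; rewrite invf_lt1 // ltr1n.
have H := cvg_ratio_fixed p01; apply/andP; split.
  apply: (ler_cvg_to (cvg_cst (ratio_lower p)) H).
  by near=> N; apply: ratio_ge => //; near: N; exact: nbhs_infty_gt.
have err : ratio_upper p + 36 * (- ln p) / p ^+ 2 / N%:R @[N --> \oo] --> ratio_upper p.
  rewrite -[X in _ --> X]addr0; apply: cvgD; first exact: cvg_cst.
  rewrite -[X in _ --> X](mulr0 (36 * (- ln p) / p ^+ 2)); apply: cvgM; first exact: cvg_cst.
  by rewrite -cvg_shiftS; exact: cvg_invn.
apply: (ler_cvg_to H err).
by near=> N; apply: ratio_le => //; near: N; exact: nbhs_infty_gt.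
Unshelve. all: by end_near. Qed.

Lemma cvg_ratio_powR (b : R) : 0 < b < 2^-1 ->
  cost_ratio N (N%:R `^ (- b)) @[N --> \oo] --> ((ln 2 ^+ 2)^-1 : R).
Proof.
move=> /andP[b0 b2].
pose u (n : nat) : R := n.+1%:R `^ (- b).
have u0 n : 0 < u n by apply: powR_gt0; rewrite ltr0n.
have u_cvg : u n @[n --> \oo] --> (0 : R) by exact: cvg_powRN.
have comp (f : R -> R) (l : R) : f x @[x --> (0 : R)^'+] --> l -> f (u n) @[n --> \oo] --> l.
  by move=> fl; have [/(_ fl u) H _] := cvg_at_rightP f 0 l; apply: H.
(* Half of the gap [1 - 2 b] in the exponent of the error term: one half absorbs the logarithm, the
   other is left as decay. *)
pose g : R := 2^-1 - b.
have g0 : 0 < g by rewrite subr_gt0.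
rewrite -cvg_shiftS.
change (cost_ratio n.+1 (u n) @[n --> \oo] --> ((ln 2 ^+ 2)^-1 : R)).
pose hi (n : nat) : R := ratio_upper (u n) + 36 * b / g * (n.+1%:R `^ (- g)).
apply: (@squeeze_cvgr nat \oo _ R (fun n => ratio_lower (u n)) hi (fun n => cost_ratio n.+1 (u n))).
- near=> n.
  have un2 : u n <= 2^-1.
    by near: n; apply: (cvgr_le _ u_cvg); rewrite invr_gt0.
  have un1 : u n < 1 by rewrite (le_lt_trans un2) // invf_lt1 // ltr1n.
  rewrite ratio_ge //=; last by rewrite u0.
  apply: le_trans (ratio_le _ (ltn0Sn n)) _; first by rewrite u0.
  rewrite lerD2l /u ln_powR.
  set x : R := n.+1%:R; have x0 : 0 < x by rewrite ltr0n.
  rewrite -powR_mulrn ?powR_ge0 // -powRrM -powRN !mulNr !opprK.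
  (* the error term is at most a multiple of x ^ (g + 2 b - 1) = x ^ (- g) *)
  have lnx : ln x <= x `^ g / g.
    rewrite ler_pdivlMr // mulrC -ln_powR ltW // ln_sublinear // powR_gt0 //.
  have -> : 36 * b / g * x `^ (- g) = 36 * b * (x `^ g / g) * x `^ (b * 2) / x.
    have -> : - g = g + (b * 2 - 1) by rewrite /g; field.
    rewrite !powRD ?(gt_eqF x0) ?implybT // powR_inv1 ?ltW //.
    by field; rewrite !gt_eqF.
  rewrite ler_wpM2r ?invr_ge0 ?(ltW x0) // ler_wpM2r ?powR_ge0 //.
  by rewrite -[leRHS]mulrA ler_wpM2l // ler_wpM2l // ltW.
- exact: comp cvg_ratio_lower.
- rewrite -[X in _ --> X]addr0; apply: cvgD; first exact: comp cvg_ratio_upper.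
  rewrite -[X in _ --> X](mulr0 (36 * b / g)); apply: cvgM; first exact: cvg_cst.
  exact: cvg_powRN.
Unshelve. all: by end_near. Qed.

End Limits.

Theorem theorem1 (R : realType) (beta : R) :
  0 <= beta < 2^-1 ->
  lim_beta beta
    (fun (N : nat) (p : R) => Tbar N p / (N%:R * p * `|ln p|))
    (((ln (2 : R)) ^+ 2)^-1).
Proof.
move=> /andP[b0 b2]; rewrite /lim_beta; case: ifPn => [b_gt0|_].
  by apply: cvg_ratio_powR; rewrite b_gt0.
exists 2^-1; split; first by rewrite invr_gt0.
(* The limit over [N] is known only as an infimum; its explicit bounds squeeze it as [p] tends to
   0. *)
exists (fun p => inf [set Tbar N.+1 p / N.+1%:R | N in setT] / (p * `|ln p|)); split.
  move=> p /andP[p0 p2]; apply: cvg_ratio_fixed; rewrite p0 (lt_trans p2) //.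
  by rewrite invf_lt1 // ltr1n.
apply: squeeze_cvgr (@cvg_ratio_lower R) (@cvg_ratio_upper R).
by near=> p; apply: inf_Tbar_div_bounds; near: p; exact: near_at_right0.
Unshelve. all: by end_near. Qed.
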